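(* For any $k\ge 2$, \textsc{Maximum Rainbow $k$-Coloring} parameterized by $q$ has a kernel of size $O(q)$: there is a polynomial-time algorithm that, given an instance $(G,q)$, returns an equivalent instance with $O(q)$ vertices.
   Context: A path is rainbow if its edges have pairwise different colors. \textsc{Maximum Rainbow $k$-Coloring}: given a graph $G=(V,E)$ and an integer $q$, decide whether there is a coloring of $E$ with $k$ colors such that at least $q$ anti-edges (pairs of distinct non-adjacent vertices) are connected by a rainbow path. Two instances are equivalent if both are YES-instances or both are NO-instances. *)

(* Defs.v *)
From mathcomp Require Import all_boot.

Set Implicit Arguments.
Unset Strict Implicit.
Unset Printing Implicit Defensive.

(** * Maximum Rainbow k-Coloring *)

Definition anti_edges (T : finType) (e : rel T) : {set {set T}} :=
  [set [set xy.1; xy.2] | xy : T * T & (xy.1 != xy.2) && ~~ e xy.1 xy.2].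

(* An edge uv is the set [set u; v], so a coloring does not see the
   orientation of an edge. A coloring is total on {set T}, but only its values
   on edges are ever inspected. *)
Definition rainbow_connected (T : finType) (e : rel T) k
    (c : {ffun {set T} -> 'I_k}) (x y : T) : Prop :=
  exists p : seq T,
    [/\ path e x p, last x p = y, uniq (x :: p)
      & uniq (pairmap (fun u v => c [set u; v]) x p)].

Definition max_rainbow (T : finType) (e : rel T) k (q : nat) : Prop :=
  exists (c : {ffun {set T} -> 'I_k}) (S : {set {set T}}),
    [/\ S \subset anti_edges e,
        forall x y : T, [set x; y] \in S -> rainbow_connected e c x y
      & q <= #|S|].

Record instance := Instance {
  nverts : nat;
  adj : rel 'I_nverts;
  adj_sym : symmetric adj;
  adj_irr : irreflexive adj;
  quota : nat
}.

Definition yes_instance k (I : instance) : Prop := max_rainbow (@adj I) k (quota I).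

(** * Polynomial time

   The machine is the unit-cost random access machine with addition and
   truncated subtraction but no multiplication. Apart from loading a literal of
   the program, an operation at most doubles the
   largest number in memory, so numbers gain at most one bit per step and the
   machine is polynomially equivalent to Turing machines (Cook and Reckhow
   1973). Memory consists of scalars and one-dimensional arrays of natural
   numbers, each named by a number; a program is finite, so it only uses a
   fixed number of them. *)

Inductive expr :=
| Const of nat
| Var of nat
| Read of nat & expr
| Add of expr & expr
| Sub of expr & expr.

Inductive cmd :=
| Skip
| Assign of nat & expr
| Store of nat & expr & expr
| Seq of cmd & cmd
| If of expr & cmd & cmd
| While of expr & cmd.

Record state := State { var : nat -> nat; arr : nat -> nat -> nat }.

Definition set_var (s : state) x v : state :=
  State (fun y => if y == x then v else var s y) (arr s).

Definition set_arr (s : state) a i v : state :=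
  State (var s)
    (fun b j => if (b == a) && (j == i) then v else arr s b j).

Fixpoint eval (s : state) (e : expr) : nat :=
  match e with
  | Const m => m
  | Var x => var s x
  | Read a e1 => arr s a (eval s e1)
  | Add e1 e2 => eval s e1 + eval s e2
  | Sub e1 e2 => eval s e1 - eval s e2
  end.

Fixpoint ecost (e : expr) : nat :=
  match e with
  | Const _ | Var _ => 1
  | Read _ e1 => (ecost e1).+1
  | Add e1 e2 | Sub e1 e2 => (ecost e1 + ecost e2).+1
  end.

(* [exec c s t s']: c started in s halts in s' after t steps. A guard holds
   when its value is nonzero. *)
Inductive exec : cmd -> state -> nat -> state -> Prop :=
| ExecSkip s : exec Skip s 1 s
| ExecAssign s x e :
    exec (Assign x e) s (ecost e).+1 (set_var s x (eval s e))
| ExecStore s a i e :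
    exec (Store a i e) s (ecost i + ecost e).+1
      (set_arr s a (eval s i) (eval s e))
| ExecSeq c1 c2 s1 s2 s3 t1 t2 :
    exec c1 s1 t1 s2 -> exec c2 s2 t2 s3 -> exec (Seq c1 c2) s1 (t1 + t2) s3
| ExecIfTrue e c1 c2 s s' t :
    eval s e != 0 -> exec c1 s t s' -> exec (If e c1 c2) s (ecost e + t).+1 s'
| ExecIfFalse e c1 c2 s s' t :
    eval s e == 0 -> exec c2 s t s' -> exec (If e c1 c2) s (ecost e + t).+1 s'
| ExecWhileTrue e c s1 s2 s3 t1 t2 :
    eval s1 e != 0 -> exec c s1 t1 s2 -> exec (While e c) s2 t2 s3 ->
    exec (While e c) s1 (ecost e + t1 + t2).+1 s3
| ExecWhileFalse e c s :
    eval s e == 0 -> exec (While e c) s (ecost e).+1 s.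

(* An instance is held in memory as its order in scalar 0, its quota in
   scalar 1 and its adjacency matrix, row by row, in array 0. *)
Definition holds (s : state) (I : instance) : Prop :=
  [/\ var s 0 = nverts I, var s 1 = quota I
    & forall i j : 'I_(nverts I), arr s 0 (i * nverts I + j) = adj i j].

(* All memory outside the encoding of the input is initially 0. *)
Definition load (I : instance) : state :=
  State
    (fun x => match x with 0 => nverts I | 1 => quota I | _ => 0 end)
    (fun a m =>
       (a == 0) &&
       [exists i : 'I_(nverts I), exists j : 'I_(nverts I),
          (m == i * nverts I + j) && adj i j] : nat).

Definition bits (m : nat) : nat := (trunc_log 2 m).+1.

(* The quota counts with its binary length. *)
Definition input_size (I : instance) : nat :=
  bits (nverts I) + bits (quota I) + nverts I ^ 2.

Definition poly_time (f : instance -> instance) : Prop :=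
  exists (prog : cmd) (a d : nat), forall I : instance,
    exists (t : nat) (s : state),
      [/\ exec prog (load I) t s, holds s (f I) & t <= a * input_size I ^ d].

(* Main.v *)
Require Import Defs.
From mathcomp Require Import all_boot.
From mathcomp Require Import zify.

Set Implicit Arguments.
Unset Strict Implicit.
Unset Printing Implicit Defensive.

(** Call a vertex inner if some vertex lies at distance exactly 2 from it; the
    other vertices are adjacent to their whole connected component. If there are
    at least 4q inner vertices, then at least 2q pairs are at distance 2, and a
    uniform 2-coloring makes each of them rainbow connected with probability
    1/2 or more, so the instance is a YES-instance. Otherwise, every anti-edge
    inside a component joins two inner vertices. In a component with a inner
    vertices and at least a dominating ones, choose distinct dominating vertices
    h(w) for the inner w and give color 1 to the edges w h(w), color 0 to the
    others: then all anti-edges of the component are rainbow connected, by the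
    paths x h(x) y. So only a of the dominating vertices need be kept, which
    leaves at most twice as many vertices as there are inner ones. *)

(** * Inner and dominating vertices *)

Lemma eq_set2 (T : finType) (x y u v : T) : [set x; y] = [set u; v] ->
  (x = u /\ y = v) \/ (x = v /\ y = u).
Proof.
move=> E; have := set21 x y; rewrite E => /set2P[] xE; subst x; [left|right]; split=> //.
  have := set22 u v; rewrite -E => /set2P[vu|//].
  by have := set22 u y; rewrite E vu => /set2P[].
have := set21 u v; rewrite -E => /set2P[uv|//].
by have := set22 v y; rewrite E uv => /set2P[].
Qed.

Section Graph.
Variables (T : finType) (e : rel T).
Hypotheses (e_sym : symmetric e) (e_irr : irreflexive e).

Definition inner : {set T} :=
  [set v | [exists m, exists w, [&& e v m, e m w, w != v & ~~ e v w]]].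

Definition component (v : T) : {set T} := [set w | connect e v w].

Definition inner_comp v := inner :&: component v.
Definition dom_comp v := ~: inner :&: component v.

(* The index is that of v among the dominating vertices of its component; it is
   junk (the size of the list) when v is inner. *)
Definition kept : {set T} :=
  [set v | (v \in inner) || (index v (enum (dom_comp v)) < #|inner_comp v|)].

Lemma connect_csym : connect_sym e.
Proof. exact: sym_connect_sym. Qed.

Lemma component_refl v : v \in component v.
Proof. by rewrite inE connect0. Qed.

Lemma component_eq v w : w \in component v -> component w = component v.
Proof.
by rewrite inE => vw; apply/setP=> x; rewrite !inE (same_connect connect_csym vw).
Qed.

(** Induction along a path from [v]: the penultimate vertex is [v] itself or a neighbour of [v], so
    a last vertex not adjacent to [v] would make [v] inner. *)
Lemma dominating v w : v \notin inner -> connect e v w -> w != v -> e v w.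
Proof.
move=> vU /connectP[p]; elim/last_ind: p w => [|p y IHp] w /=; first by move=> _ ->; rewrite eqxx.
rewrite rcons_path last_rcons => /andP[pp ey] -> yv.
have [lv|lv] := eqVneq (last v p) v; first by rewrite -{1}lv.
have el := IHp _ pp erefl lv.
apply/negPn/negP => nvy; case/negP: vU; rewrite inE.
by apply/existsP; exists (last v p); apply/existsP; exists y; rewrite el ey yv nvy.
Qed.

Lemma inner_ends x y : x != y -> ~~ e x y -> connect e x y -> x \in inner.
Proof.
move=> xy nxy cxy; apply/negPn/negP => xU.
by move: nxy; rewrite (dominating xU cxy) // eq_sym.
Qed.

Lemma inner_kept v : v \in inner -> v \in kept.
Proof. by move=> vI; rewrite inE vI. Qed.

(** The kept dominating vertex of index i in its component is sent to the inner vertex of index i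
    there; this is injective. *)
Lemma card_kept : #|kept| <= 2 * #|inner|.
Proof.
have -> : kept = inner :|: (kept :\: inner).
  by apply/setP=> v; rewrite !inE; case: ([exists m, _]).
apply: leq_trans (leq_card_setU _ _) _; rewrite mul2n -addnn leq_add2l.
pose h u := nth u (enum (inner_comp u)) (index u (enum (dom_comp u))).
have hP u : u \in kept :\: inner ->
    h u \in inner_comp u /\ index (h u) (enum (inner_comp u)) = index u (enum (dom_comp u)).
  rewrite inE => /andP[uU]; rewrite inE (negbTE uU) /=.
  rewrite cardE => lt.
  by rewrite -[h u \in _]mem_enum mem_nth // index_uniq ?enum_uniq.
rewrite -(card_in_imset (f := h)).
  apply/subset_leq_card/subsetP => _ /imsetP[u /hP[hu _] ->].
  by move: hu; rewrite inE => /andP[].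
move=> u1 u2 H1 H2 eh; have [m1 i1] := hP _ H1; have [m2 i2] := hP _ H2.
have eC : component u1 = component u2.
  move: m1 m2; rewrite -eh !inE => /andP[_ c1] /andP[_ c2].
  by rewrite -(@component_eq u1 (h u1)) ?inE // -(@component_eq u2 (h u1)) ?inE.
have eI : inner_comp u1 = inner_comp u2 by rewrite /inner_comp eC.
have eD : dom_comp u1 = dom_comp u2 by rewrite /dom_comp eC.
have inD u : u \in kept :\: inner -> u \in enum (dom_comp u).
  by rewrite mem_enum inE => /andP[uU _]; rewrite inE component_refl inE uU.
have := inD _ H1; have := inD _ H2; rewrite -eD => d2 d1.
have ei : index u1 (enum (dom_comp u1)) = index u2 (enum (dom_comp u1)).
  by rewrite -i1 eI eh i2 eD.
by rewrite -(nth_index u1 d1) ei (nth_index u1 d2).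
Qed.

(** * Matching inner vertices with dominating ones *)

Definition rich v := #|inner_comp v| <= #|dom_comp v|.

(** This is h(w) of the overview, obtained by matching indices within the component. The default of
    [nth] is not reached for an inner [w] in a rich component. *)
Definition helper w := nth w (enum (dom_comp w)) (index w (enum (inner_comp w))).

Lemma rich_comp v w : w \in component v -> rich w = rich v.
Proof. by move=> /component_eq eC; rewrite /rich /inner_comp /dom_comp eC. Qed.

(** In a poor component the index of a dominating vertex is below the number of dominating vertices,
    hence below that of inner ones. *)
Lemma kept_poor v : ~~ rich v -> v \in kept.
Proof.
rewrite -ltnNge => lt; rewrite inE; have [//|vU /=] := boolP (v \in inner).
apply: leq_ltn_trans lt; rewrite cardE ltnW // index_mem mem_enum.
by rewrite inE component_refl inE vU.
Qed.

Section Helper.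
Variable w : T.
Hypotheses (wI : w \in inner) (w_rich : rich w).

Let index_lt : index w (enum (inner_comp w)) < #|inner_comp w|.
Proof. by rewrite cardE index_mem mem_enum inE wI component_refl. Qed.

Let index_lt_dom : index w (enum (inner_comp w)) < size (enum (dom_comp w)).
Proof. by rewrite -cardE; apply: leq_trans index_lt w_rich. Qed.

Lemma helper_dom : helper w \in dom_comp w.
Proof. by rewrite -mem_enum mem_nth. Qed.

Lemma index_helper :
  index (helper w) (enum (dom_comp w)) = index w (enum (inner_comp w)).
Proof. by rewrite index_uniq ?enum_uniq. Qed.

Lemma helper_notin : helper w \notin inner.
Proof. by move: helper_dom; rewrite inE in_setC => /andP[]. Qed.

Lemma helper_comp : helper w \in component w.
Proof. by move: helper_dom; rewrite inE => /andP[]. Qed.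

Lemma helper_kept : helper w \in kept.
Proof.
have eC := component_eq helper_comp.
by rewrite inE /dom_comp /inner_comp eC index_helper index_lt orbT.
Qed.

Lemma helper_adj x : x \in component w -> x \in inner -> e (helper w) x.
Proof.
move=> xw xI; apply: dominating helper_notin _ _.
  by have := xw; rewrite -(component_eq helper_comp) inE.
by apply: contraNneq helper_notin => <-.
Qed.
End Helper.

(** Within a component, the index of [helper w] determines that of [w]. *)
Lemma helper_inj w1 w2 : w1 \in inner -> w2 \in inner -> rich w1 ->
  w2 \in component w1 -> helper w1 = helper w2 -> w1 = w2.
Proof.
move=> I1 I2 r1 c12 eh; have eC := component_eq c12.
have r2 : rich w2 by rewrite (rich_comp c12).
have := index_helper I2 r2; have := index_helper I1 r1.
rewrite /dom_comp /inner_comp eC -eh => -> ei.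
have m1 : w1 \in enum (inner :&: component w1) by rewrite mem_enum inE I1 component_refl.
have m2 : w2 \in enum (inner :&: component w1) by rewrite mem_enum inE I2 c12.
by rewrite -(nth_index w1 m1) ei (nth_index w1 m2).
Qed.

(** * Recoloring the rich components *)

Section Recolor.
Variables (k : nat) (hk : 2 <= k) (c : {ffun {set T} -> 'I_k}).

Definition color0 : 'I_k := Ordinal (ltnW hk).
Definition color1 : 'I_k := Ordinal hk.

(** Poor components are kept whole, so [c] can stay as it is there. *)
Definition recolor : {ffun {set T} -> 'I_k} :=
  [ffun X : {set T} => if [exists x in X, rich x]
    then if [exists w in X :&: inner, helper w \in X] then color1 else color0
    else c X].

(** In a poor component the given path survives: its vertices are kept and its colors do not change.
    In a rich one it is replaced by x, [helper x], y. *)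
Lemma recolor_connected x y : x != y -> ~~ e x y -> rainbow_connected e c x y ->
  exists p, [/\ path e x p, last x p = y, uniq (x :: p),
    uniq (pairmap (fun u v => recolor [set u; v]) x p) & {subset x :: p <= kept}].
Proof.
move=> xy nxy [p [pp lp up uc]].
have cxy : connect e x y by apply/connectP; exists p.
have [rx|prx] := boolP (rich x); last first.
  have poor v : v \in x :: p -> ~~ rich v.
    by move=> vp; rewrite (@rich_comp x) // inE; apply: path_connect pp _ vp.
  exists p; split=> // [|v /poor]; last exact: kept_poor.
  suff -> : pairmap (fun u v => recolor [set u; v]) x p =
            pairmap (fun u v => c [set u; v]) x p by [].
  elim: p x poor {xy nxy pp lp up uc cxy prx} => //= z p IHp x poor.
  rewrite IHp => [|v vp]; last by apply: poor; rewrite inE vp orbT.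
  congr (_ :: _); rewrite ffunE; case: ifP => // /existsP[v].
  rewrite !inE => /andP[vX rv]; suff: ~~ rich v by rewrite rv.
  by apply: poor; rewrite !inE; case/orP: vX => ->; rewrite ?orbT.
have xI := inner_ends xy nxy cxy.
have yI : y \in inner by apply: (@inner_ends y x); rewrite 1?eq_sym 1?e_sym 1?connect_csym.
have yx : y \in component x by rewrite inE.
have ex : e x (helper x) by rewrite e_sym helper_adj ?component_refl.
have ey := helper_adj xI rx yx yI.
have hN := helper_notin xI rx.
have hx : helper x != x by apply: contraNneq hN => ->.
have hy : helper x != y by apply: contraNneq hN => ->.
have ry : rich y by rewrite (rich_comp yx).
exists [:: helper x; y]; split => //=.
- by rewrite ex ey.
- by rewrite !inE negb_or xy hy eq_sym hx.
- rewrite inE andbT !ffunE.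
  have -> : [exists z in [set x; helper x], rich z].
    by apply/existsP; exists x; rewrite !inE eqxx.
  have -> : [exists z in [set helper x; y], rich z].
    by apply/existsP; exists y; rewrite !inE eqxx orbT.
  have -> : [exists w in [set x; helper x] :&: inner, helper w \in [set x; helper x]].
    by apply/existsP; exists x; rewrite in_setI xI !inE !eqxx orbT.
  (* The second edge has color 0: its only inner end is [y], and [helper y] is neither [helper x],
     by injectivity, nor [y], which is inner. *)
  case: ifP => // /existsP[w]; rewrite in_setI => /andP[/andP[wX wI]].
  have wy : w = y.
    by move: wX; rewrite !inE => /orP[] /eqP // wE; rewrite -wE wI in hN.
  rewrite wy !inE => /orP[/eqP hyx|/eqP hyy].
    by rewrite (helper_inj xI yI rx yx) ?eqxx in xy.
  by have := helper_notin yI ry; rewrite hyy yI.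
- by move=> z; rewrite 3!in_cons orbF => /or3P[] /eqP->; rewrite ?helper_kept // inner_kept.
Qed.
End Recolor.


Lemma anti_edgeP x y : ([set x; y] \in anti_edges e) = (x != y) && ~~ e x y.
Proof.
apply/imsetP/idP => [[[u v]]|H]; last by exists (x, y); rewrite ?inE.
by rewrite inE /= => uv /eq_set2[] [-> ->] //; rewrite eq_sym e_sym.
Qed.

(** * Passing to the subgraph induced by the kept vertices *)

Section Induced.
Variables (T' : finType) (h : T' -> T).
Hypotheses (h_inj : injective h) (h_kept : kept = [set h i | i : T']).

Lemma anti_edges_induced : anti_edges (relpre h e) =
  [set Y : {set T'} | h @: Y \in anti_edges e].
Proof.
apply/setP=> Y; rewrite inE; apply/imsetP/imsetP=> -[[x y]]; rewrite inE /= => /andP[xy nxy] eY.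
  by exists (h x, h y); rewrite ?inE /= ?(inj_eq h_inj) ?xy //= eY imsetU1 imset_set1.
have: x \in h @: Y by rewrite eY set21.
have: y \in h @: Y by rewrite eY set22.
case/imsetP=> j _ yE /imsetP[i _ xE]; exists (i, j).
  by rewrite inE /= -xE -yE nxy andbT; apply: contraNneq xy => ij; rewrite xE yE ij.
by apply: (imset_inj h_inj); rewrite eY imsetU1 imset_set1 xE yE.
Qed.

(** Rainbow paths of the subgraph remain rainbow in the graph. Conversely, after recoloring, every
    pair of [S] is joined by a rainbow path through kept vertices only, so no pair is lost. *)
Lemma max_rainbow_induced k q : 2 <= k ->
  max_rainbow (relpre h e) k q <-> max_rainbow e k q.
Proof.
move=> hk; split=> -[c [S [Santi Sconn Sq]]].
  exists [ffun X : {set T} => c (h @^-1: X)], [set h @: Y | Y : {set T'} in S]; split.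
  - apply/subsetP=> _ /imsetP[Y YS ->].
    by have := subsetP Santi _ YS; rewrite anti_edges_induced inE.
  - move=> x y /imsetP[Y YS eY].
    have: x \in h @: Y by rewrite -eY set21.
    have: y \in h @: Y by rewrite -eY set22.
    case/imsetP=> j _ yE /imsetP[i _ xE]; subst.
    have YE : Y = [set i; j] by apply: (imset_inj h_inj); rewrite -eY imsetU1 imset_set1.
    have [p [pp lp up uc]] : rainbow_connected (relpre h e) c i j by apply: Sconn; rewrite -YE.
    exists (map h p); split.
    + by rewrite path_map.
    + by rewrite last_map lp.
    + by rewrite -map_cons map_inj_uniq.
    + suff -> : pairmap (fun u v => [ffun X : {set T} => c (h @^-1: X)] [set u; v]) (h i) (map h p)
        = pairmap (fun u v => c [set u; v]) i p by [].
      elim: p i {pp lp up uc YE eY} => //= z p IHp i; rewrite IHp ffunE; congr (c _ :: _).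
      by apply/setP=> w; rewrite !inE !(inj_eq h_inj).
  - by rewrite card_imset //; apply: imset_inj.
pose S' := [set Y : {set T'} | h @: Y \in S].
have conn x y : [set x; y] \in S -> exists p, [/\ path e x p, last x p = y, uniq (x :: p),
    uniq (pairmap (fun u v => recolor hk c [set u; v]) x p) & {subset x :: p <= kept}].
  move=> xyS; have := subsetP Santi _ xyS; rewrite anti_edgeP => /andP[xy nxy].
  exact: recolor_connected xy nxy (Sconn _ _ xyS).
exists [ffun Y : {set T'} => recolor hk c (h @: Y)], S'; split.
- by apply/subsetP=> Y; rewrite anti_edges_induced !inE; apply: (subsetP Santi).
- move=> i j; rewrite in_set imsetU1 imset_set1 => /conn[p [pp lp up uc pK]].
  have [p' pE] : exists p', p = map h p'.
    have {}pK : {subset p <= kept} by move=> z zp; apply: pK; rewrite inE zp orbT.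
    elim: p pK {pp lp up uc} => [|z p IHp] pK; first by exists [::].
    have [p' ->] : exists p', p = map h p'.
      by apply: IHp => w wp; apply: pK; rewrite inE wp orbT.
    have := pK z (mem_head _ _); rewrite h_kept => /imsetP[z' _ ->].
    by exists (z' :: p').
  subst p; exists p'; split.
  + by rewrite path_map in pp.
  + by apply: h_inj; rewrite -last_map.
  + by rewrite -map_cons map_inj_uniq in up.
  + suff <- : pairmap (fun u v => recolor hk c [set u; v]) (h i) (map h p')
        = pairmap (fun u v => [ffun Y : {set T'} => recolor hk c (h @: Y)] [set u; v]) i p' by [].
    elim: p' i {pp lp up uc pK} => //= z p IHp i; rewrite IHp; congr (_ :: _).
    by rewrite [RHS]ffunE imsetU1 imset_set1.
- apply: leq_trans Sq _.
  (* Each pair in [S] is the image of a pair of [T'], because its ends lie on a path through kept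
     vertices. *)
  rewrite -(card_imset (mem S') (imset_inj h_inj)); apply/subset_leq_card/subsetP=> X XS.
  have /imsetP[[x y] /= _ XE] := subsetP Santi _ XS.
  rewrite {X}XE in XS *; have [p [_ lp _ _ pK]] := conn x y XS.
  have := pK x (mem_head _ _); have := pK y; rewrite -{1}lp mem_last => /(_ isT).
  rewrite h_kept => /imsetP[j _ yE] /imsetP[i _ xE].
  apply/imsetP; exists [set i; j]; last by rewrite imsetU1 imset_set1 xE yE.
  by rewrite inE imsetU1 imset_set1 -xE -yE.
Qed.
End Induced.

(** * A good 2-coloring by averaging *)

Section Averaging.
Variables (k : nat) (hk : 2 <= k).

Definition dist2_pairs : {set {set T}} :=
  [set X | [exists w, exists m, exists p,
    [&& X == [set w; p], e w m, e m p, p != w & ~~ e w p]]].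

(** Each inner vertex lies in one of the pairs, and a pair covers at most two vertices. *)
Lemma inner_dist2_pairs : #|inner| <= 2 * #|dist2_pairs|.
Proof.
apply: (@leq_trans #|cover dist2_pairs|).
  apply/subset_leq_card/subsetP => w; rewrite inE.
  case/existsP=> m /existsP[p H]; apply/bigcupP; exists [set w; p]; last exact: set21.
  by rewrite inE; apply/existsP; exists w; apply/existsP; exists m;
     apply/existsP; exists p; rewrite eqxx.
apply: leq_trans (leq_card_cover _) _.
rewrite mulnC -sum_nat_const; apply: leq_sum => X; rewrite inE.
case/existsP=> w /existsP[m /existsP[p /and5P[/eqP-> _ _ _ _]]].
by rewrite cards2; case: (_ != _).
Qed.

(** The two colors are [bool], so that toggling one is an exclusive or. *)
Definition bicolored (c : {ffun {set T} -> bool}) (X : {set T}) : bool :=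
  [exists w, exists m, exists p,
    [&& X == [set w; p], e w m, e m p, (p != w) && ~~ e w p &
        c [set w; m] != c [set m; p]]].

(* Toggling the color of one edge of a path w m p exchanges the colorings for
   which it is rainbow with the others. *)
Lemma bicolored_half X : X \in dist2_pairs ->
  #|{ffun {set T} -> bool}| <= 2 * #|[set c | bicolored c X]|.
Proof.
rewrite inE => /existsP[w /existsP[m /existsP[p /and5P[XE ewm emp pw nwp]]]].
pose A := [set c : {ffun {set T} -> bool} | c [set w; m] != c [set m; p]].
have AX : A \subset [set c | bicolored c X].
  apply/subsetP => c; rewrite !inE => cA.
  apply/existsP; exists w; apply/existsP; exists m; apply/existsP; exists p.
  by rewrite XE ewm emp pw nwp.
apply: (@leq_trans (2 * #|A|)); last by rewrite leq_mul2l subset_leq_card.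
rewrite -(cardsC A) mul2n -addnn leq_add2l.
pose flip (c : {ffun {set T} -> bool}) :=
  [ffun Y : {set T} => c Y (+) (Y == [set w; m])].
have flip_inj : injective flip.
  move=> c d /ffunP H; apply/ffunP=> Y; have := H Y; rewrite !ffunE.
  exact: addIb.
rewrite -(card_imset _ flip_inj); apply/subset_leq_card/subsetP => _ /imsetP[c cA ->].
(* Toggling [w m] leaves the other edge alone: equal edges would force [p = w] or a loop at [m]. *)
have ne : ([set m; p] == [set w; m]) = false.
  apply/negbTE; apply: contraTneq pw => E.
  have: p \in [set w; m] by rewrite -E set22.
  rewrite !inE negbK => /orP[-> //|/eqP pm].
  by rewrite pm e_irr in emp.
by move: cA; rewrite !inE !ffunE eqxx ne negbK addbF => /eqP ->; case: (c _).
Qed.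

(** Double counting: every pair is bicolored by at least half of all colorings, so a coloring with
    the largest count bicolors at least half of the pairs. *)
Lemma exists_bicoloring : exists c : {ffun {set T} -> bool},
  #|dist2_pairs| <= 2 * #|[set X in dist2_pairs | bicolored c X]|.
Proof.
pose F (c : {ffun {set T} -> bool}) := #|[set X in dist2_pairs | bicolored c X]|.
pose cmax := [arg max_(c > [ffun=> true]) F c]; exists cmax.
have cmaxP c : F c <= F cmax by rewrite /cmax; case: arg_maxnP => // d _; apply.
pose N := #|{ffun {set T} -> bool}|.
have sumN n : \sum_(c : {ffun {set T} -> bool}) n = N * n.
  by rewrite -sum_nat_const; apply: eq_bigl.
have N_gt0 : 0 < N by apply/card_gt0P; exists [ffun=> true].
rewrite -(leq_pmul2l N_gt0) -[X in _ <= X]sumN; apply: (@leq_trans (2 * \sum_c F c)); last first.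
  by rewrite big_distrr /=; apply: leq_sum => c _; rewrite leq_mul2l cmaxP.
rewrite /F.
rewrite (eq_bigr (fun c => \sum_(X in dist2_pairs) bicolored c X)); last first.
  move=> c _; rewrite -sum1_card (eq_bigl (fun X => (X \in dist2_pairs) && bicolored c X)).
    by rewrite big_mkcondr; apply: eq_bigr => X _; case: (bicolored c X).
  by move=> X; rewrite inE.
rewrite exchange_big /= mulnC -sum_nat_const big_distrr /=.
apply: leq_sum => X /bicolored_half; congr (_ <= 2 * _).
rewrite -sum1dep_card big_mkcond.
by apply: eq_bigr => c _; case: (bicolored c X).
Qed.

(** One factor 2 of the 4 is lost from inner vertices to pairs at distance 2, the other from these
    pairs to the bicolored ones. *)
Lemma max_rainbow_inner q : 4 * q <= #|inner| -> max_rainbow e k q.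
Proof.
move=> qI; have [c cP] := exists_bicoloring.
pose col b : 'I_k := if b then color1 hk else color0 hk.
have col_inj : injective col by case=> -[].
exists [ffun X => col (c X)], [set X in dist2_pairs | bicolored c X]; split.
- apply/subsetP=> X; rewrite !inE => /andP[/existsP[w /existsP[m /existsP[p]]]].
  by case/and5P=> /eqP-> _ _ pw nwp _; rewrite anti_edgeP eq_sym pw.
- suff conn w m p : e w m -> e m p -> p != w -> c [set w; m] != c [set m; p] ->
    rainbow_connected e [ffun X => col (c X)] w p.
    move=> x y; rewrite !inE => /andP[_ /existsP[w /existsP[m /existsP[p]]]].
    case/and5P=> /eqP E ewm emp /andP[pw nwp] cc.
    have [[-> ->]|[-> ->]] := eq_set2 E.
    + exact: conn ewm emp pw cc.
    + apply: (conn p m w); rewrite 1?e_sym 1?eq_sym //.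
      by rewrite setUC [[set p; m]]setUC.
  move=> ewm emp pw cc; exists [:: m; p]; split=> //=.
  + by rewrite ewm emp.
  + rewrite !inE negb_or eq_sym [w == p]eq_sym pw !andbT.
    by apply/andP; split; [apply: contraTneq ewm|apply: contraTneq emp] => ->; rewrite e_irr.
  + by rewrite inE !ffunE (inj_eq col_inj) cc.
- have := inner_dist2_pairs; lia.
Qed.
End Averaging.

End Graph.

(** * Loop programs *)

(* Programs whose only loops run over [0 <= x < var 0]: every such program
   terminates, in time polynomial in the scalar 0, with a computable result. *)
Inductive fcmd :=
| FAssign of nat & expr
| FStore of nat & expr & expr
| FSeq of fcmd & fcmd
| FIf of expr & fcmd
| FFor of nat & fcmd.

Fixpoint compile (p : fcmd) : cmd :=
  match p with
  | FAssign x e => Assign x e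
  | FStore a i e => Store a i e
  | FSeq p1 p2 => Seq (compile p1) (compile p2)
  | FIf e p1 => If e (compile p1) Skip
  | FFor x p1 => Seq (Assign x (Const 0))
      (While (Defs.Sub (Var 0) (Var x))
        (Seq (compile p1) (Assign x (Add (Var x) (Const 1)))))
  end.

(** The number of rounds of a loop is fixed on entry. The compiled guard agrees because [wf] forbids
    writing scalar 0, or a counter inside its own loop. *)
Fixpoint den (p : fcmd) (s : state) : state :=
  match p with
  | FAssign x e => set_var s x (eval s e)
  | FStore a i e => set_arr s a (eval s i) (eval s e)
  | FSeq p1 p2 => den p2 (den p1 s)
  | FIf e p1 => if eval s e != 0 then den p1 s else s
  | FFor x p1 =>
      iter (var s 0) (fun s => set_var (den p1 s) x (var (den p1 s) x + 1))
        (set_var s x 0)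
  end.

Fixpoint wvars (p : fcmd) : seq nat :=
  match p with
  | FAssign x _ => [:: x]
  | FStore _ _ _ => [::]
  | FSeq p1 p2 => wvars p1 ++ wvars p2
  | FIf _ p1 => wvars p1
  | FFor x p1 => x :: wvars p1
  end.

Fixpoint warrs (p : fcmd) : seq nat :=
  match p with
  | FAssign _ _ => [::]
  | FStore a _ _ => [:: a]
  | FSeq p1 p2 => warrs p1 ++ warrs p2
  | FIf _ p1 => warrs p1
  | FFor x p1 => warrs p1
  end.

Fixpoint wf (p : fcmd) : bool :=
  match p with
  | FAssign x _ => x != 0
  | FStore _ _ _ => true
  | FSeq p1 p2 => wf p1 && wf p2
  | FIf _ p1 => wf p1
  | FFor x p1 => [&& x != 0, x \notin wvars p1 & wf p1]
  end.

Lemma wf_wvars p : wf p -> 0 \notin wvars p.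
Proof.
elim: p => //= [x e|p1 IH1 p2 IH2 /andP[/IH1 n1 /IH2 n2]|x p IHp /and3P[x0 _ /IHp n1]].
- by rewrite inE eq_sym.
- by rewrite mem_cat negb_or n1.
- by rewrite inE negb_or eq_sym x0.
Qed.

Lemma var_den p s x : x \notin wvars p -> var (den p s) x = var s x.
Proof.
elim: p s => //= [y e|p1 IH1 p2 IH2|e p IHp|y p IHp] s.
- by rewrite inE => /negbTE ->.
- by rewrite mem_cat negb_or => /andP[n1 n2]; rewrite IH2 ?IH1.
- by move=> n1; case: ifP => // _; apply: IHp.
- rewrite inE negb_or => /andP[/negbTE xy n1].
  by elim: (var s 0) => /= [|i IHi]; rewrite xy // IHp.
Qed.

Lemma arr_den p s a m : a \notin warrs p -> arr (den p s) a m = arr s a m.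
Proof.
elim: p s => //= [b i e|p1 IH1 p2 IH2|e p IHp|y p IHp] s.
- by rewrite inE => /negbTE ->.
- by rewrite mem_cat negb_or => /andP[n1 n2]; rewrite IH2 ?IH1.
- by move=> n1; case: ifP => // _; apply: IHp.
- by move=> n1; elim: (var s 0) => //= i IHi; rewrite IHp.
Qed.

(** * Running time of loop programs *)

Fixpoint fcost (p : fcmd) (n : nat) : nat :=
  match p with
  | FAssign _ e => (ecost e).+1
  | FStore _ i e => (ecost i + ecost e).+1
  | FSeq p1 p2 => fcost p1 n + fcost p2 n
  | FIf e p1 => (ecost e + fcost p1 n).+2
  | FFor _ p1 => n * (fcost p1 n + 8) + 6
  end.

(** In [fcost], a round of a loop adds 4 steps for the test and 4 for the increment; the 6 pays for
    the initialization and the final test. *)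
Lemma exec_compile p s : wf p ->
  exists t, exec (compile p) s t (den p s) /\ t <= fcost p (var s 0).
Proof.
elim: p s => [x e|a i e|p1 IH1 p2 IH2|e p IHp|x p IHp] s /=.
- by move=> _; exists (ecost e).+1; split=> //; apply: ExecAssign.
- by move=> _; exists (ecost i + ecost e).+1; split=> //; apply: ExecStore.
- case/andP=> w1 w2; have [t1 [e1 l1]] := IH1 s w1.
  have [t2 [e2]] := IH2 (den p1 s) w2; rewrite (var_den _ (wf_wvars w1)) => l2.
  by exists (t1 + t2); split; [apply: ExecSeq e1 e2 | apply: leq_add].
- move=> w1; have [t1 [e1 l1]] := IHp s w1; case: ifP => [nz|/negbFE z].
    by exists (ecost e + t1).+1; split; [apply: ExecIfTrue | lia].
  exists (ecost e + 1).+1; split; last by lia.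
  exact: ExecIfFalse z (ExecSkip s).
case/and3P=> x0 xp wp; pose step s := set_var (den p s) x (var (den p s) x + 1).
rewrite -[iter _ _ _]/(iter (var s 0) step (set_var s x 0)).
(* Generalized to a loop whose counter is [i] with [d] rounds left. *)
suff loop i d s' : var s' 0 = i + d -> var s' x = i ->
    exists t, exec (While (Defs.Sub (Var 0) (Var x))
        (Seq (compile p) (Assign x (Add (Var x) (Const 1))))) s' t (iter d step s') /\
      t <= d * (fcost p (i + d) + 8) + 4.
  have [||t [et lt]] := loop 0 (var s 0) (set_var s x 0); rewrite /= ?eqxx 1?eq_sym ?(negbTE x0) //.
  exists (2 + t); split; last by move: lt; rewrite add0n; lia.
  by apply: (@ExecSeq _ _ _ (set_var s x 0)) et; apply: (ExecAssign s x (Const 0)).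
elim: d i s' => [|d IHd] i s' v0 vx.
  by exists 4; split=> //; apply: (@ExecWhileFalse (Defs.Sub (Var 0) (Var x)));
     rewrite /= v0 vx addn0 subnn.
have [t1 [e1 l1]] := IHp s' wp.
have [||t2 [e2 l2]] := IHd i.+1 (step s').
- by rewrite /= eq_sym (negbTE x0) (var_den _ (wf_wvars wp)) v0 addnS.
- by rewrite /= eqxx var_den // vx addn1.
exists ((3 + (t1 + 4)) + t2).+1; split; last first.
  by move: l1 l2; rewrite v0 addSnnS mulSn; lia.
rewrite iterSr; apply: (@ExecWhileTrue (Defs.Sub (Var 0) (Var x))) e2.
  by rewrite /= v0 vx addKn.
by apply: ExecSeq e1 _; apply: (ExecAssign (den p s') x (Add (Var x) (Const 1))).
Qed.

(** Each loop raises the exponent by one. The base [n.+1] is positive, so additive constants are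
    absorbed into the coefficient. *)
Lemma fcost_poly p : exists a d, forall n, fcost p n <= a * n.+1 ^ d.
Proof.
elim: p => [x e|b i e|p1 [a1 [d1 H1]] p2 [a2 [d2 H2]]|e p [a [d H]]|x p [a [d H]]] /=.
- by exists (ecost e).+1, 0 => n; rewrite muln1.
- by exists (ecost i + ecost e).+1, 0 => n; rewrite muln1.
- exists (a1 + a2), (d1 + d2) => n; rewrite mulnDl leq_add //.
    apply: leq_trans (H1 n) _; apply: leq_mul => //; apply: leq_pexp2l => //; lia.
  apply: leq_trans (H2 n) _; apply: leq_mul => //; apply: leq_pexp2l => //; lia.
- exists (a + (ecost e).+2), d => n; have := H n.
  have : 0 < n.+1 ^ d by rewrite expn_gt0.
  by nia.
- exists (a + 14), d.+1 => n; have := H n.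
  have : 0 < n.+1 ^ d by rewrite expn_gt0.
  by rewrite expnS; nia.
Qed.

(** * Frame conditions and loop invariants *)

Definition agree (X A : seq nat) (s s' : state) :=
  (forall x, x \notin X -> var s' x = var s x) /\
  (forall a m, a \notin A -> arr s' a m = arr s a m).

Lemma agree_den p s : agree (wvars p) (warrs p) s (den p s).
Proof. by split=> [x|a m]; [apply: var_den | apply: arr_den]. Qed.

Lemma agreeW X A X' A' s s' : {subset X <= X'} -> {subset A <= A'} ->
  agree X A s s' -> agree X' A' s s'.
Proof.
move=> sX sA [vs as_]; split=> [x xX|a m aA]; [apply: vs | apply: as_].
  by apply: contra xX => /sX.
by apply: contra aA => /sA.
Qed.

Lemma agree_trans X A s1 s2 s3 : agree X A s1 s2 -> agree X A s2 s3 -> agree X A s1 s3.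
Proof. by move=> [v1 a1] [v2 a2]; split=> *; rewrite ?v2 ?a2 ?v1 ?a1. Qed.

Lemma agree_set_var X A s x v : x \in X -> agree X A s (set_var s x v).
Proof.
move=> xX; split=> //= y yX; case: eqP => // yx; by rewrite -yx (negbTE yX) in xX *.
Qed.

(** Invariant rule: [P i] describes the state at the head of round [i]. Each round is also given the
    frame, so [P] need only mention what changes. *)
Lemma for_ind x p s (P : nat -> state -> Prop) :
  wf (FFor x p) -> P 0 (set_var s x 0) ->
  (forall i s', i < var s 0 -> agree (x :: wvars p) (warrs p) s s' ->
     var s' x = i -> P i s' -> P i.+1 (set_var (den p s') x i.+1)) ->
  P (var s 0) (den (FFor x p) s).
Proof.
move=> /= /and3P[x0 xp wp] P0 PS; pose step s := set_var (den p s) x (var (den p s) x + 1).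
rewrite -[iter _ _ _]/(iter (var s 0) step (set_var s x 0)).
suff loop i : i <= var s 0 -> let s' := iter i step (set_var s x 0) in
    [/\ agree (x :: wvars p) (warrs p) s s', var s' x = i & P i s'].
  by have [] := loop (var s 0) (leqnn _).
elim: i => [_|i IHi lt] /=.
  by split=> //; rewrite ?eqxx //; apply: agree_set_var; rewrite inE eqxx.
have [ag vx Pi] := IHi (ltnW lt); set s' := iter i _ _ in ag vx Pi *.
have vx' : var (den p s') x + 1 = i.+1 by rewrite var_den // vx addn1.
split.
- apply: agree_trans ag _; rewrite /step vx'; apply: (@agree_trans _ _ _ (den p s')).
    by apply: agreeW (agree_den p s') => // y yp; rewrite inE yp orbT.
  by apply: agree_set_var; rewrite inE eqxx.
- by rewrite /= eqxx.
- by rewrite /step vx'; apply: PS.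
Qed.

Lemma sum_loop x acc p s g : wf (FFor x p) -> acc != x ->
  (forall i s', i < var s 0 -> agree (x :: wvars p) (warrs p) s s' -> var s' x = i ->
     var (den p s') acc = var s' acc + g i) ->
  var (den (FFor x p) s) acc = var s acc + \sum_(i < var s 0) g i.
Proof.
move=> wp /negbTE ax H.
apply: (@for_ind x p s (fun i s' => var s' acc = var s acc + \sum_(j < i) g j)) => //=.
  by rewrite ax big_ord0 addn0.
by move=> i s' lt ag vx IH; rewrite ax (H i) // IH big_ord_recr addnA.
Qed.

(* Fills array a over the index var 3; p accumulates one summand, with summation
   index var 4, into var 6, and h turns the sum into the entry. *)
Definition table a p h :=
  FFor 3 (FSeq (FAssign 6 (Const 0)) (FSeq (FFor 4 p) (FStore a (Var 3) h))).

(** Invariant of the outer loop: the entries below the counter are final. The condition on [wvars p]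
    protects the counters 3 and 4. *)
Lemma table_spec a p h s (g : nat -> nat -> nat) (H : nat -> nat) :
  let n := var s 0 in
  wf p -> all (mem [:: 5; 6]) (wvars p) -> warrs p = [::] ->
  (forall i j s', i < n -> j < n -> agree [:: 3; 4; 5; 6] [:: a] s s' ->
     var s' 3 = i -> var s' 4 = j -> var (den p s') 6 = var s' 6 + g i j) ->
  (forall i s', i < n -> agree [:: 3; 4; 5; 6] [:: a] s s' ->
     var s' 3 = i -> var s' 6 = \sum_(j < n) g i j -> eval s' h = H i) ->
  forall i, i < n -> arr (den (table a p h) s) a i = H i.
Proof.
move=> n wp /allP sp ap Hg Hh.
have np x : x \notin [:: 5; 6] -> x \notin wvars p by move/negP=> nx; apply/negP => /sp.
have sub : {subset 4 :: wvars p <= [:: 3; 4; 5; 6]}.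
  by move=> x; rewrite inE => /orP[/eqP->|/sp] //; rewrite !inE => /orP[] ->; rewrite ?orbT.
apply: (@for_ind 3 _ s (fun k s' => forall i, i < k -> arr s' a i = H i)) => //.
  by rewrite /= wp cats0 !inE (negbTE (np 3 isT)) (np 4 isT).
move=> i s' lt ag vi IH; rewrite [den _ _]/(den (FStore a (Var 3) h) (den (FFor 4 p) (set_var s' 6 0))).
set s1 := set_var s' 6 0; set s2 := den (FFor 4 p) s1.
have {}ag : agree [:: 3; 4; 5; 6] [:: a] s s'.
  apply: agreeW ag => [x|x] /=.
    rewrite cats0 !inE => /or4P[->|->|->|/sp] //; rewrite ?orbT //.
    by rewrite !inE => /orP[] ->; rewrite ?orbT.
  by rewrite /= ap.
have ag1 : agree [:: 3; 4; 5; 6] [:: a] s s1 by apply: agree_trans ag _; apply: agree_set_var.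
have n1 : var s1 0 = n by case: ag1 => -> .
have ag12 : agree [:: 3; 4; 5; 6] [:: a] s1 s2.
  by apply: agreeW (agree_den (FFor 4 p) s1) => //=; rewrite ap.
have v3 : var s2 3 = i by rewrite var_den //= inE /= np.
have v6 : var s2 6 = \sum_(j < n) g i j.
  rewrite /s2 (@sum_loop 4 6 p s1 (g i)) ?n1 //=; first by rewrite (np 4).
  move=> j s3 ltj ag3 v4; apply: Hg => //.
    by apply: agree_trans ag1 _; apply: agreeW ag3 => //; rewrite ap.
  by case: ag3 => -> //; rewrite inE np.
move=> j; rewrite /= eqxx v3 /= ltnS leq_eqVlt; case: eqP => [-> _|_ /= ltj].
  by apply: Hh => //; apply: agree_trans ag1 ag12.
rewrite -(IH _ ltj); case: (agree_den (FFor 4 p) s1) => _ /(_ a j) /= -> //.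
by rewrite ap.
Qed.

Definition copy2 a b e1 e2 := FFor 3 (FFor 4 (FIf b (FStore a e1 e2))).

(* That each entry written is a function G of its address spares us from
   proving the addresses distinct. *)
Lemma copy2_spec a b e1 e2 s (bv idx : nat -> nat -> nat) (G : nat -> nat) :
  let n := var s 0 in
  (forall i j s', i < n -> j < n -> agree [:: 3; 4] [:: a] s s' ->
     var s' 3 = i -> var s' 4 = j ->
     [/\ eval s' b = bv i j, eval s' e1 = idx i j &
         bv i j != 0 -> eval s' e2 = G (idx i j)]) ->
  forall i j, i < n -> j < n -> bv i j != 0 ->
    arr (den (copy2 a b e1 e2) s) a (idx i j) = G (idx i j).
Proof.
move=> n H.
(* A row preserves the entries that already agree with [G] and makes its own agree, even where
   addresses coincide. *)
have inner i s' : i < n -> agree [:: 3; 4] [:: a] s s' -> var s' 3 = i ->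
    let s'' := den (FFor 4 (FIf b (FStore a e1 e2))) s' in
    (forall m, arr s' a m = G m -> arr s'' a m = G m) /\
    (forall j, j < n -> bv i j != 0 -> arr s'' a (idx i j) = G (idx i j)).
  move=> lti ag v3; have n1 : var s' 0 = n by case: ag => ->.
  have := @for_ind 4 (FIf b (FStore a e1 e2)) s' (fun k s'' =>
    (forall m, arr s' a m = G m -> arr s'' a m = G m) /\
    (forall j, j < k -> bv i j != 0 -> arr s'' a (idx i j) = G (idx i j))).
  rewrite n1; apply=> //.
  move=> j s'' ltj ag' v4 [IH1 IH2].
  have [||Hb He1 He2] := H i j s'' lti ltj _ _ v4.
  - by apply: agree_trans ag _; apply: agreeW ag' => // x; rewrite !inE => ->; rewrite ?orbT.
  - by case: ag' => ->.
  rewrite /= Hb; case: ifP => [nz|z]; last first.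
    split=> //= k ltk nz; move: ltk; rewrite ltnS leq_eqVlt => /orP[/eqP kj|/IH2]; last exact.
    by rewrite -kj nz in z.
  split=> [m Em|k ltk nzk] /=; rewrite eqxx He1 /= He2 //; case: eqP => [-> //|ne].
    exact: IH1.
  move: ltk; rewrite ltnS leq_eqVlt => /orP[/eqP kj|/IH2]; last exact.
  by case: ne; rewrite kj.
apply: (@for_ind 3 _ s (fun k s' => forall i j, i < k -> j < n -> bv i j != 0 ->
   arr s' a (idx i j) = G (idx i j))) => //.
move=> k s' ltk ag v3 IH i j lti ltj nz; have [C1 C2] := inner k s' ltk ag v3.
change (arr (den (FFor 4 (FIf b (FStore a e1 e2))) s') a (idx i j) = G (idx i j)).
move: lti; rewrite ltnS leq_eqVlt => /orP[/eqP ik|lti]; first by subst i; apply: C2.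
by apply: C1; apply: IH.
Qed.

(** * The kernelization program *)

(* Truncated subtraction: [e1 - (1 - e2)] is the conjunction when e1 is 0 or 1. *)
Definition EAnd e1 e2 := Defs.Sub e1 (Defs.Sub (Const 1) e2).
Definition ENot e := Defs.Sub (Const 1) e.
Definition ELt x y := Defs.Sub (Var y) (Var x).
Definition EAdj x y := Read 0 (Add (Read 1 (Var x)) (Var y)).
Definition FAdd acc e := FAssign acc (Add (Var acc) e).

(* Arrays: 1 holds i * n at i, 2 the inner vertices, 3 the kept vertices, 4 the
   rank of a kept vertex, 6 the rank times the new order, 7 a copy of the
   adjacency matrix, 8 the number of earlier dominating neighbours. Scalars: 8
   and 9 count the inner and the kept vertices. *)
Definition row_start := table 1 (FAdd 6 (Var 3)) (Var 6).
(** The new matrix overwrites array 0 while old entries are still needed. *)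
Definition save_adj :=
  copy2 7 (Const 1) (Add (Read 1 (Var 3)) (Var 4)) (EAdj 3 4).
(** The sum of the two differences is nonzero exactly when the end vertices differ; the double
    negation turns the count into 0 or 1. *)
Definition find_inner :=
  table 2
    (FFor 5 (FAdd 6 (EAnd (EAdj 3 4) (EAnd (EAdj 4 5)
       (EAnd (ENot (EAdj 3 5)) (Add (ELt 3 5) (ELt 5 3)))))))
    (ENot (ENot (Var 6))).
(** No connectivity is computed: a dominating vertex is adjacent to the rest of its component, so
    its index is the number of earlier dominating neighbours. Entries at inner vertices are junk. *)
Definition count_before :=
  table 8 (FAdd 6 (EAnd (EAdj 3 4) (EAnd (ENot (Read 2 (Var 4))) (ELt 4 3)))) (Var 6).
(** The inner neighbours of a dominating vertex are all the inner vertices of its component. *)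
Definition find_kept :=
  table 3 (FAdd 6 (EAnd (EAdj 3 4) (Read 2 (Var 4))))
    (ENot (ENot (Add (Read 2 (Var 3)) (Defs.Sub (Var 6) (Read 8 (Var 3)))))).
Definition rank_kept :=
  table 4 (FAdd 6 (EAnd (Read 3 (Var 4)) (ELt 4 3))) (Var 6).
Definition count_inner := FFor 3 (FAdd 8 (Read 2 (Var 3))).
Definition count_kept := FFor 3 (FAdd 9 (Read 3 (Var 3))).
Definition new_row_start :=
  table 6 (FIf (Read 3 (Var 4)) (FAdd 6 (Read 4 (Var 3)))) (Var 6).
Definition write_adj :=
  copy2 0 (EAnd (Read 3 (Var 3)) (Read 3 (Var 4)))
    (Add (Read 6 (Var 3)) (Read 4 (Var 4)))
    (Read 7 (Add (Read 1 (Var 3)) (Var 4))).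

Definition kernel_prog :=
  FSeq row_start (FSeq save_adj (FSeq find_inner (FSeq count_before (FSeq find_kept
    (FSeq rank_kept (FSeq count_inner (FSeq count_kept
      (FSeq new_row_start write_adj)))))))).

(** * What the program computes *)

Section Semantics.
Variables (n : nat) (A : nat -> nat -> bool).

Definition innern i := 0 < \sum_(j < n) \sum_(l < n)
  [&& A i j, A j l, ~~ A i l & l != i :> nat].
Definition beforen i := \sum_(j < n) [&& A i j, ~~ innern j & j < i].
Definition keptn i := innern i || (beforen i < \sum_(j < n) (A i j && innern j)).
Definition rankn i := \sum_(j < n) (keptn j && (j < i)).

Lemma sub_not (b : bool) m : b - (1 - m) = b && (0 < m).
Proof. by case: b m => -[|m]. Qed.

Lemma sub_notK m : 1 - (1 - m) = (0 < m).
Proof. by case: m. Qed.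

Lemma not_bool (b : bool) : 1 - b = ~~ b.
Proof. by case: b. Qed.

Definition known (F : nat -> nat) a s := forall i, i < n -> arr s a i = F i.
Definition known2 (s : state) a :=
  forall i j, i < n -> j < n -> arr s a (i * n + j) = A i j.

Lemma known_agree X B s s' a F : a \notin B -> agree X B s s' -> known F a s -> known F a s'.
Proof. by move=> aB [_ ag] K i lti; rewrite ag ?K. Qed.

Lemma known2_agree X B s s' a : a \notin B -> agree X B s s' -> known2 s a -> known2 s' a.
Proof. by move=> aB [_ ag] K i j lti ltj; rewrite ag ?K. Qed.

Lemma known_den p s a F : a \notin warrs p -> known F a s -> known F a (den p s).
Proof. by move=> ap; apply: known_agree ap (agree_den p s). Qed.

Lemma known2_den p s a : a \notin warrs p -> known2 s a -> known2 (den p s) a.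
Proof. by move=> ap; apply: known2_agree ap (agree_den p s). Qed.

Definition rows := known (fun i => i * n) 1.

(** The machine cannot multiply, so [i * n] is formed as a sum of [n] copies of [i]. *)
Lemma row_start_spec s : var s 0 = n -> rows (den row_start s).
Proof.
move=> sn i lti.
rewrite (@table_spec 1 _ _ s (fun i _ => i) (fun i => i * n)) ?sn //.
  by move=> {lti}i j s' _ _ _ /= -> _.
by move=> {lti}i s' _ _ _ /= ->; rewrite sum_nat_const card_ord mulnC.
Qed.

Lemma save_adj_spec s : var s 0 = n -> rows s -> known2 s 0 -> known2 (den save_adj s) 7.
Proof.
move=> sn R K i j lti ltj; rewrite -K //.
apply: (@copy2_spec 7 _ _ _ s (fun _ _ => 1) (fun i j => i * n + j) (arr s 0)); rewrite ?sn //.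
move=> {lti ltj}i {}j s' lti ltj ag /= -> ->.
have [_ ag'] := ag; by rewrite ag' // ag' // R.
Qed.

Lemma find_inner_spec s : var s 0 = n -> rows s -> known2 s 0 ->
  known innern 2 (den find_inner s).
Proof.
move=> sn R K i lti; rewrite (@table_spec 2 _ _ s
  (fun i j => \sum_(l < n) [&& A i j, A j l, ~~ A i l & l != i :> nat]) innern) ?sn //.
  move=> {lti}i j s' lti ltj ag v3 v4.
  have sn' : var s' 0 = n by case: ag => ->.
  rewrite (@sum_loop 5 6 _ s' (fun l => [&& A i j, A j l, ~~ A i l & l != i])) ?sn' //.
  move=> l s'' ltl ag' v5; have v3' : var s'' 3 = i by case: ag' => ->.
  have v4' : var s'' 4 = j by case: ag' => ->.
  have K'' : known2 s'' 0 by apply: known2_agree ag' _ => //; apply: known2_agree ag _.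
  have R'' : rows s'' by apply: known_agree ag' _ => //; apply: known_agree ag _.
  rewrite [den _ _]/(set_var _ _ _) [LHS]/=; congr (_ + _).
  rewrite v3' v4' v5 !R'' // !K'' // not_bool !sub_not !lt0b.
  by congr (nat_of_bool [&& _, _, _ & _]); lia.
by move=> {lti}i s' _ _ _ /= ->; rewrite sub_notK.
Qed.

Lemma count_before_spec s : var s 0 = n -> rows s -> known2 s 0 -> known innern 2 s ->
  known beforen 8 (den count_before s).
Proof.
move=> sn R K I i lti; rewrite (@table_spec 8 _ _ s
  (fun i j => [&& A i j, ~~ innern j & j < i]) beforen) ?sn //.
move=> {lti}i j s' lti ltj ag v3 v4.
have K' : known2 s' 0 by apply: known2_agree ag _.
have R' : rows s' by apply: known_agree ag _.
have I' : known innern 2 s' by apply: known_agree ag _.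
by rewrite /= v3 v4 R' // K' // I' // not_bool !sub_not !lt0b subn_gt0.
Qed.

Lemma find_kept_spec s : var s 0 = n -> rows s -> known2 s 0 -> known innern 2 s ->
  known beforen 8 s -> known keptn 3 (den find_kept s).
Proof.
move=> sn R K I B i lti; rewrite (@table_spec 3 _ _ s
  (fun i j => A i j && innern j) keptn) ?sn //.
  move=> {lti}i j s' lti ltj ag v3 v4.
  have K' : known2 s' 0 by apply: known2_agree ag _.
  have R' : rows s' by apply: known_agree ag _.
  have I' : known innern 2 s' by apply: known_agree ag _.
  by rewrite /= v3 v4 R' // K' // I' // sub_not lt0b.
move=> {lti}i s' lti ag v3 v6.
have I' : known innern 2 s' by apply: known_agree ag _.
have B' : known beforen 8 s' by apply: known_agree ag _.
by rewrite /= v3 v6 I' // B' // sub_notK addn_gt0 lt0b subn_gt0.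
Qed.

Lemma rank_kept_spec s : var s 0 = n -> known keptn 3 s ->
  known rankn 4 (den rank_kept s).
Proof.
move=> sn K i lti; rewrite (@table_spec 4 _ _ s
  (fun i j => keptn j && (j < i)) rankn) ?sn //.
move=> {lti}i j s' lti ltj ag v3 v4.
have K' : known keptn 3 s' by apply: known_agree ag _.
by rewrite /= v3 v4 K' // sub_not subn_gt0.
Qed.

Lemma count_spec s x a (F : nat -> bool) : x \notin [:: 0; 3] -> var s 0 = n -> var s x = 0 ->
  known F a s -> var (den (FFor 3 (FAdd x (Read a (Var 3)))) s) x = \sum_(i < n) F i.
Proof.
rewrite !inE negb_or => /andP[x0 x3] sn sx K.
rewrite (@sum_loop 3 x _ s F) ?sn ?sx //; last first.
  move=> i s' lti ag v3; have K' : known F a s' by apply: known_agree ag _.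
  by rewrite /= eqxx v3 K'.
by rewrite /= x0 inE eq_sym x3.
Qed.

Definition newn := \sum_(i < n) keptn i.

Lemma new_row_start_spec s : var s 0 = n -> known keptn 3 s -> known rankn 4 s ->
  known (fun i => rankn i * newn) 6 (den new_row_start s).
Proof.
move=> sn K R i lti; rewrite (@table_spec 6 _ _ s
  (fun i j => rankn i * keptn j) (fun i => rankn i * newn)) ?sn //.
  move=> {lti}i j s' lti ltj ag v3 v4.
  have K' : known keptn 3 s' by apply: known_agree ag _.
  have R' : known rankn 4 s' by apply: known_agree ag _.
  by rewrite /= v4 K' //; case: (keptn j); rewrite /= ?v3 ?R' // ?muln1 ?muln0 ?addn0.
by move=> {lti}i s' _ _ _ /= ->; rewrite big_distrr.
Qed.

(** [G] is the intended content of the new matrix as a function of the address. *)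
Lemma write_adj_spec s (G : nat -> nat) : var s 0 = n -> rows s -> known2 s 7 ->
  known keptn 3 s -> known rankn 4 s -> known (fun i => rankn i * newn) 6 s ->
  (forall i j, i < n -> j < n -> keptn i -> keptn j ->
     G (rankn i * newn + rankn j) = A i j) ->
  forall i j, i < n -> j < n -> keptn i -> keptn j ->
    arr (den write_adj s) 0 (rankn i * newn + rankn j) = A i j.
Proof.
move=> sn R A7 K3 K4 K6 HG i j lti ltj ki kj; rewrite -HG //.
apply: (@copy2_spec 0 _ _ _ s (fun i j => keptn i && keptn j)
  (fun i j => rankn i * newn + rankn j) G); rewrite ?sn ?ki ?kj //.
move=> {lti ltj ki kj}i {}j s' lti ltj ag v3 v4.
have K3' : known keptn 3 s' by apply: known_agree ag _.
have K4' : known rankn 4 s' by apply: known_agree ag _.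
have K6' : known (fun i => rankn i * newn) 6 s' by apply: known_agree ag _.
have R' : rows s' by apply: known_agree ag _.
have A7' : known2 s' 7 by apply: known2_agree ag _.
rewrite /= v3 v4 !K3' // K6' // K4' // R' // A7' // sub_not lt0b; split=> //.
by rewrite eqb0 negbK => /andP[ki kj]; rewrite HG.
Qed.

Lemma kernel_prog_spec s (G : nat -> nat) : var s 0 = n -> var s 8 = 0 -> var s 9 = 0 ->
  known2 s 0 ->
  (forall i j, i < n -> j < n -> keptn i -> keptn j ->
     G (rankn i * newn + rankn j) = A i j) ->
  [/\ var (den kernel_prog s) 8 = \sum_(i < n) innern i,
      var (den kernel_prog s) 9 = newn
    & forall i j, i < n -> j < n -> keptn i -> keptn j ->
      arr (den kernel_prog s) 0 (rankn i * newn + rankn j) = A i j].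
Proof.
move=> n0 v80 v90 A0 HG.
pose s1 := den row_start s; have n1 : var s1 0 = n by rewrite var_den.
have R1 : rows s1 by apply: row_start_spec.
have A1 : known2 s1 0 by apply: known2_den.
pose s2 := den save_adj s1; have n2 : var s2 0 = n by rewrite var_den.
have C2 : known2 s2 7 by apply: save_adj_spec.
have R2 : rows s2 by apply: known_den.
have A2 : known2 s2 0 by apply: known2_den.
pose s3 := den find_inner s2; have n3 : var s3 0 = n by rewrite var_den.
have I3 : known innern 2 s3 by apply: find_inner_spec.
have R3 : rows s3 by apply: known_den.
have A3 : known2 s3 0 by apply: known2_den.
have C3 : known2 s3 7 by apply: known2_den.
pose s4 := den count_before s3; have n4 : var s4 0 = n by rewrite var_den.
have B4 : known beforen 8 s4 by apply: count_before_spec.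
have R4 : rows s4 by apply: known_den.
have A4 : known2 s4 0 by apply: known2_den.
have C4 : known2 s4 7 by apply: known2_den.
have I4 : known innern 2 s4 by apply: known_den.
pose s5 := den find_kept s4; have n5 : var s5 0 = n by rewrite var_den.
have K5 : known keptn 3 s5 by apply: find_kept_spec.
have R5 : rows s5 by apply: known_den.
have C5 : known2 s5 7 by apply: known2_den.
have I5 : known innern 2 s5 by apply: known_den.
pose s6 := den rank_kept s5; have n6 : var s6 0 = n by rewrite var_den.
have L6 : known rankn 4 s6 by apply: rank_kept_spec.
have R6 : rows s6 by apply: known_den.
have C6 : known2 s6 7 by apply: known2_den.
have I6 : known innern 2 s6 by apply: known_den.
have K6 : known keptn 3 s6 by apply: known_den.
pose s7 := den count_inner s6; have n7 : var s7 0 = n by rewrite var_den.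
have v87 : var s7 8 = \sum_(i < n) innern i by apply: count_spec; rewrite ?var_den.
have L7 : known rankn 4 s7 by apply: known_den.
have R7 : rows s7 by apply: known_den.
have C7 : known2 s7 7 by apply: known2_den.
have K7 : known keptn 3 s7 by apply: known_den.
pose s8 := den count_kept s7; have n8 : var s8 0 = n by rewrite var_den.
have v98 : var s8 9 = newn by apply: count_spec; rewrite ?var_den.
have L8 : known rankn 4 s8 by apply: known_den.
have R8 : rows s8 by apply: known_den.
have C8 : known2 s8 7 by apply: known2_den.
have K8 : known keptn 3 s8 by apply: known_den.
pose s9 := den new_row_start s8; have n9 : var s9 0 = n by rewrite var_den.
have M9 : known (fun i => rankn i * newn) 6 s9 by apply: new_row_start_spec.
have L9 : known rankn 4 s9 by apply: known_den.
have R9 : rows s9 by apply: known_den.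
have C9 : known2 s9 7 by apply: known2_den.
have K9 : known keptn 3 s9 by apply: known_den.
rewrite -[den kernel_prog s]/(den write_adj s9); split.
- by rewrite var_den // /s9 var_den // /s8 var_den.
- by rewrite var_den // /s9 var_den.
- exact: write_adj_spec HG.
Qed.
End Semantics.

(** * Indices as counts of smaller elements *)

Lemma sum_bool_card (T : finType) (P : pred T) : \sum_x (P x : nat) = #|[set x | P x]|.
Proof.
rewrite -sum1dep_card [RHS]big_mkcond.
by apply: eq_bigr => x _; case: (P x).
Qed.

(** In a strictly increasing list, the elements before [i] are exactly the smaller ones. *)
Lemma index_sorted (s : seq nat) i : sorted ltn s -> i \in s ->
  index i s = count (fun j => j < i) s.
Proof.
elim: s => //= x s IHs xs; rewrite inE eq_sym.
have lts : all (ltn x) s by apply: order_path_min xs; apply: ltn_trans.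
case: eqP => [<- _|_ /= is_].
  rewrite ltnn; apply/esym/eqP; rewrite -leqn0 leqNgt -has_count; apply/hasPn => y.
  by move/(allP lts) => /= /ltnW; rewrite leqNgt.
by have /= -> := allP lts _ is_; rewrite IHs // (path_sorted xs).
Qed.

Lemma index_enum_ord n (B : {set 'I_n}) i : i \in B ->
  index i (enum B) = \sum_(j < n) ((j \in B) && (j < i)).
Proof.
move=> iB; rewrite -(index_map val_inj) index_sorted; last first.
- by rewrite (mem_map val_inj) mem_enum.
- rewrite {1}/enum_mem; apply: (subseq_sorted ltn_trans (s2 := map val (enum 'I_n))).
    by apply: map_subseq; rewrite enumT; apply: filter_subseq.
  by rewrite val_enum_ord iota_ltn_sorted.
rewrite count_map -sum1_count big_enum_cond big_mkcond /=.
by apply: eq_bigr => j _; case: (_ && _).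
Qed.

(** Its quota 0 makes it a YES-instance. *)
Definition empty_instance : instance :=
  @Instance 0 (fun _ _ => false) (fun _ _ => erefl) (fun _ => erefl) 0.

(** * The kernel and its agreement with the program *)

Section Kernel.
Variable I : instance.
Let n := nverts I.
Let e := @adj I.

Definition kernel_adj : rel 'I_#|kept e| := relpre enum_val e.

Lemma kernel_adj_sym : symmetric kernel_adj.
Proof. by move=> i j; apply: adj_sym. Qed.

Lemma kernel_adj_irr : irreflexive kernel_adj.
Proof. by move=> i; apply: adj_irr. Qed.

Definition kernel : instance := Instance kernel_adj_sym kernel_adj_irr (quota I).

Definition input_adj i j := arr (load I) 0 (i * n + j) != 0.

(** Division with remainder by [n] recovers row and column from the address. *)
Lemma input_adjE (i j : 'I_n) : input_adj i j = e i j.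
Proof.
rewrite /input_adj /= eqb0 negbK; apply/existsP/idP => [[i' /existsP[j' /andP[/eqP E]]]|eij].
  have n0 : 0 < n by apply: leq_ltn_trans (ltn_ord i).
  have -> : i' = i.
    by apply: val_inj; have := congr1 (fun m => m %/ n) E; rewrite /= !divnMDl // !divn_small // !addn0.
  suff -> : j' = j by [].
  by apply: val_inj; have := congr1 (fun m => m %% n) E; rewrite /= !modnMDl !modn_small.
by exists i; apply/existsP; exists j; rewrite eqxx.
Qed.

Lemma innernE (i : 'I_n) : innern n input_adj i = (i \in inner e).
Proof.
rewrite inE /innern lt0n sum_nat_eq0 negb_forall; apply/existsP/existsP => -[j].
  rewrite sum_nat_eq0 negb_forall => /existsP[l]; rewrite eqb0 negbK !input_adjE.
  by case/and4P=> *; exists j; apply/existsP; exists l; apply/and4P.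
case/existsP=> l /and4P[*]; exists j; rewrite sum_nat_eq0 negb_forall.
by apply/existsP; exists l; rewrite eqb0 negbK !input_adjE; apply/and4P.
Qed.

Lemma connect_dominating (i j : 'I_n) : i \notin inner e -> j != i ->
  connect e i j = e i j.
Proof. by move=> iU ji; apply/idP/idP => [/dominating->|/connect1]. Qed.

(** The neighbours of a non-inner [i] form its component without [i], so the counts over neighbours
    are the index and the cardinal in [kept]. *)
Lemma keptnE (i : 'I_n) : keptn n input_adj i = (i \in kept e).
Proof.
rewrite inE /keptn innernE; case: (boolP (i \in inner e)) => //= iU; congr (_ < _).
  rewrite index_enum_ord; last by rewrite in_setI in_setC iU component_refl.
  apply: eq_bigr => j _; rewrite innernE input_adjE in_setI in_setC [j \in component e i]inE.
  (* The vertex [i] is connected but not adjacent to itself; the condition [j < i] excludes it here,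
     and [j] being inner does so below. *)
  case: (ltnP j i) => ji; rewrite ?andbF // ?andbT andbC connect_dominating //.
  by apply: contraTneq ji => ->; rewrite ltnn.
rewrite /inner_comp -sum_bool_card; apply: eq_bigr => j _.
rewrite innernE input_adjE [j \in component e i]inE andbC.
case: (boolP (j \in inner e)) => //= jI; rewrite connect_dominating //.
by apply: contraNneq iU => <-.
Qed.

Lemma newnE : newn n input_adj = #|kept e|.
Proof.
rewrite /newn -cardsE -sum_bool_card.
by apply: eq_bigr => i _; rewrite keptnE.
Qed.

Lemma ranknE (i : 'I_n) : i \in kept e -> rankn n input_adj i = index i (enum (kept e)).
Proof. by move=> iK; rewrite index_enum_ord //; apply: eq_bigr => j _; rewrite keptnE. Qed.


Lemma kernel_prog_load :
  [/\ var (den kernel_prog (load I)) 8 = #|inner e|,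
      var (den kernel_prog (load I)) 9 = #|kept e|
    & forall i j : 'I_#|kept e|,
      arr (den kernel_prog (load I)) 0 (i * #|kept e| + j) = kernel_adj i j].
Proof.
pose K := enum (kept e).
(* [kv r] is the kept vertex of rank [r]; [G] decodes an address of the new matrix into two
   ranks. *)
pose kv r := nth 0 (map val K) r.
pose G p := (input_adj (kv (p %/ #|kept e|)) (kv (p %% #|kept e|)) : nat).
have HG i j : i < n -> j < n -> keptn n input_adj i -> keptn n input_adj j ->
    G (rankn n input_adj i * newn n input_adj + rankn n input_adj j) = input_adj i j.
  move=> lti ltj; rewrite -[i]/(val (Ordinal lti)) -[j]/(val (Ordinal ltj)).
  move: (Ordinal lti) (Ordinal ltj) => {lti ltj}u v.
  rewrite !keptnE newnE => uK vK; rewrite !ranknE //.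
  have lt_rank w : w \in kept e -> index w K < #|kept e|.
    by rewrite cardE index_mem mem_enum.
  have kvK w : w \in kept e -> kv (index w K) = w.
    move=> wK; rewrite /kv -(index_map val_inj) nth_index //.
    by rewrite (mem_map val_inj) mem_enum.
  rewrite /G divnMDl ?(leq_ltn_trans _ (lt_rank _ uK)) // divn_small ?lt_rank // addn0.
  by rewrite modnMDl modn_small ?lt_rank // !kvK.
have [||||v8 v9 a0] := @kernel_prog_spec n input_adj (load I) G _ _ _ _ HG => //.
  move=> i j lti ltj; rewrite /input_adj /=; by case: [exists _, _].
split.
- by rewrite v8 -cardsE -sum_bool_card; apply: eq_bigr => i _; rewrite innernE.
- by rewrite v9 newnE.
move=> i j; have kE (l : 'I_#|kept e|) : keptn n input_adj (enum_val l).
  by rewrite keptnE enum_valP.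
have rE (l : 'I_#|kept e|) : rankn n input_adj (enum_val l) = l.
  rewrite ranknE ?enum_valP // (enum_val_nth (enum_val l)) index_uniq ?enum_uniq //.
  by rewrite -cardE.
have := a0 _ _ (ltn_ord (enum_val i)) (ltn_ord (enum_val j)) (kE i) (kE j).
by rewrite newnE !rE input_adjE.
Qed.

Lemma yes_kernel k : 2 <= k -> yes_instance k kernel <-> yes_instance k I.
Proof.
move=> hk; apply: max_rainbow_induced hk; last 1 first.
- apply/setP=> v; apply/idP/imsetP => [vK|[i _ ->]]; last exact: enum_valP.
  by exists (enum_rank_in vK v); rewrite // enum_rankK_in.
- exact: adj_sym.
- exact: enum_val_inj.
Qed.

End Kernel.

(** * The kernelization algorithm *)

Definition kernelize (I : instance) : instance :=
  if 4 * quota I <= #|inner (@adj I)| then empty_instance else kernel I.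

Definition four_quota := Add (Add (Var 1) (Var 1)) (Add (Var 1) (Var 1)).

Definition kernelize_prog : cmd :=
  Seq (compile kernel_prog)
    (If (Defs.Sub four_quota (Var 8)) (Assign 0 (Var 9))
       (Seq (Assign 0 (Const 0)) (Assign 1 (Const 0)))).

(** The 14 extra steps are 10 for the test and at most 4 for the assignments. *)
Lemma exec_kernelize I : exists t s,
  [/\ exec kernelize_prog (load I) t s, holds s (kernelize I)
    & t <= fcost kernel_prog (nverts I) + 14].
Proof.
have [t [et lt]] := @exec_compile kernel_prog (load I) isT.
have [v8 v9 a0] := kernel_prog_load I.
have v1 : var (den kernel_prog (load I)) 1 = quota I by rewrite var_den.
move: (den kernel_prog (load I)) et v8 v9 a0 v1 => s et v8 v9 a0 v1.
have guard : (eval s (Defs.Sub four_quota (Var 8)) != 0) = (#|inner (@adj I)| < 4 * quota I).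
  by rewrite /= v1 v8 -lt0n subn_gt0; congr (_ < _); lia.
rewrite /kernelize; case: leqP => [le|lt'].
  do 2 eexists; split.
  - apply: ExecSeq et _; apply: ExecIfFalse; first by rewrite -[_ == _]negbK guard -leqNgt.
    by apply: ExecSeq; apply: ExecAssign.
  (* A graph of order 0 has no matrix entries, so the contents of array 0 are harmless. *)
  - by split=> // -[].
  - by move: lt => /=; lia.
do 2 eexists; split.
- by apply: ExecSeq et _; apply: ExecIfTrue; [rewrite guard | apply: ExecAssign].
- by split=> [||i j] //=; apply: a0.
- by move: lt => /=; lia.
Qed.

Lemma nverts_input_size I : nverts I < input_size I.
Proof. by rewrite /input_size /bits; case: (nverts I) => // n; nia. Qed.

Theorem theorem8 (k : nat) (hk : 2 <= k) :
  exists f : instance -> instance,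
    poly_time f /\
    exists c : nat, forall I : instance,
      [/\ yes_instance k (f I) <-> yes_instance k I,
          nverts (f I) <= c * quota I
        & quota (f I) <= c * quota I].
Proof.
exists kernelize; split.
  have [a [d ad]] := fcost_poly kernel_prog.
  exists kernelize_prog, (a + 14), d => I.
  have [t [s [ex hs lt]]] := exec_kernelize I; exists t, s; split=> //.
  apply: leq_trans lt _; rewrite mulnDl leq_add //.
    apply: leq_trans (ad _) _; rewrite leq_mul2l.
    apply/orP; right; case: d {ad} => // d.
    by rewrite leq_exp2r // nverts_input_size.
  by rewrite leq_pmulr // expn_gt0 (leq_ltn_trans _ (nverts_input_size I)).
(* Fewer than 4q inner vertices leave fewer than 8q kept ones. *)
exists 8 => I; rewrite /kernelize; case: leqP => [le|lt].
  (* Both are YES-instances: the input by averaging, the empty one by its quota 0. *)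
  split=> //; split=> _.
    by apply: (max_rainbow_inner (@adj_sym I) (@adj_irr I) hk).
  by exists [ffun=> Ordinal hk], set0; split=> [|x y|//]; rewrite ?sub0set ?inE.
split; first exact: yes_kernel.
  by apply: leq_trans (card_kept (@adj_sym I)) _; move: lt; lia.
by rewrite /=; lia.
Qed.
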